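(* Let $\mathcal{H}$ be a real Hilbert space, let $m$ be a positive integer, let $T:\mathcal{H}\to\mathcal{H}$ be a continuous linear self-adjoint operator, and let $c,c_1,\dots,c_m\in\mathcal{H}$, $\alpha_1,\dots,\alpha_m\in\mathbb{R}$. Put $f(x)=\frac12\langle x,Tx\rangle+\langle c,x\rangle$ and $F=\{x\in\mathcal{H}\mid \langle c_i,x\rangle+\alpha_i\leqslant 0,\ i=1,\dots,m\}$. Suppose that $T$ is a compact operator with closed range, that $F$ is nonempty, and that $f$ is bounded from below over $F$. Then the quadratic programming problem under linear constraints of minimizing $f(x)$ subject to $x\in F$ has a solution, i.e. there is $\bar x\in F$ with $f(\bar x)\leqslant f(x)$ for all $x\in F$.
   Context: A linear operator on $\mathcal{H}$ is compact if it transforms every weakly convergent sequence into a strongly convergent sequence. *)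

(* Defs.v *)
From HB Require Import structures.
From mathcomp Require Export all_boot all_order all_algebra.
From mathcomp Require Export all_classical all_reals all_analysis.
Export Order.TTheory GRing.Theory Num.Theory.
Export numFieldNormedType.Exports.
#[export] Set Implicit Arguments.
#[export] Unset Strict Implicit.
#[export] Unset Printing Implicit Defensive.

Local Open Scope classical_set_scope.
Local Open Scope ring_scope.

(* A real Hilbert space is a [completeNormedModType R], with [R : realType],
   together with a [{dot H for idfun}], i.e. a positive definite symmetric
   bilinear form on [H], that induces the norm of [H]. *)
Definition induces_norm (R : realType) (H : completeNormedModType R)
    (dot : {dot H for @idfun R}) : Prop :=
  forall x : H, `|x| = Num.sqrt (dot x x).

Definition self_adjoint (R : realType) (H : completeNormedModType R)
    (dot : {dot H for @idfun R}) (T : {linear H -> H}) : Prop :=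
  forall x y : H, dot (T x) y = dot x (T y).

Definition weakly_cvg_to (R : realType) (H : completeNormedModType R)
    (dot : {dot H for @idfun R}) (u : nat -> H) (l : H) : Prop :=
  forall v : H, (fun n => dot v (u n)) @ \oo --> dot v l.

(* The norm (strong) topology is the one that [cvgn] refers to. This is not
   the library's [compact], which is a property of sets. *)
Definition compact_operator (R : realType) (H : completeNormedModType R)
    (dot : {dot H for @idfun R}) (T : {linear H -> H}) : Prop :=
  forall u : nat -> H,
    (exists l : H, weakly_cvg_to dot u l) -> cvgn (fun n => T (u n)).

Definition quad_fun (R : realType) (H : completeNormedModType R)
    (dot : {dot H for @idfun R}) (T : {linear H -> H}) (c : H) (x : H) : R :=
  2^-1 * dot x (T x) + dot c x.

Definition feasible_set (R : realType) (H : completeNormedModType R)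
    (dot : {dot H for @idfun R}) (m : nat) (a : 'I_m -> H) (alpha : 'I_m -> R) :
    set H :=
  [set x | forall i : 'I_m, dot (a i) x + alpha i <= 0].

(* Main.v *)
Require Import Defs.
From mathcomp Require Import ring lra.
Local Open Scope classical_set_scope.
Local Open Scope ring_scope.

(** A compact self-adjoint operator [T] with closed range has finite rank, which
    reduces the problem to the Frank-Wolfe theorem: a quadratic function that is
    bounded from below on a nonempty polyhedron of a finite-dimensional space
    attains its infimum there.

    Finite rank ([compact_closed_range_finite_rank]).  Otherwise the range of
    [T] contains an orthonormal sequence [e].  By Bessel it converges weakly to
    0, so [T (e n)] tends to 0 in norm, by compactness and self-adjointness.
    Along a subsequence [f] with [`|T (e (f k))| <= 4^-k], the vector
    [y = \sum_k 2^-k *: e (f k)] lies in the closed range, say [y = T z], and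
    [2^-k = dot (e (f k)) (T z) = dot (T (e (f k))) z <= 4^-k * `|z|] for all
    [k], which is absurd.

    Reduction.  Let [P] be the orthogonal projection on the span of the range of
    [T], of [c] and of the [a i].  Then [P \o T = T], hence [T \o P = T] by
    self-adjointness, so neither the objective nor the constraints distinguish
    [x] from [P x]; and the closed balls of the range of [P] are compact
    ([proj_ball_compact]).

    Frank-Wolfe ([frank_wolfe]), by the argument of Blum and Oettli.  Minimize
    over the feasible points of norm at most [r], and among the minimizers take
    one of least norm.  If these points stay bounded as [r] grows, one of them is
    a global minimizer.  If not, their directions accumulate at a unit vector [u]
    along which the feasible set recedes, with [dot u (T u) = 0] because the
    objective is bounded along them.  On lines of direction [u] the objective is
    then affine, and it is nondecreasing because it is bounded from below.  Hence
    stepping from a far minimizer [x] to [x - u] keeps it feasible, does not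
    increase the objective and decreases the norm: a contradiction
    ([least_norm_at_level_bounded]). *)

(** * Geometry of the inner product *)

Section InnerProduct.
Context (R : realType) (H : completeNormedModType R)
  (dot : {dot H for @idfun R}) (hdot : induces_norm dot).
Implicit Types (x y z u : H) (s : seq H).

Lemma dotC x y : dot x y = dot y x.
Proof. by rewrite hermC/= expr0 mul1r. Qed.

Lemma dotDl x y z : dot (x + y) z = dot x z + dot y z.
Proof. by rewrite linearDl. Qed.

Lemma dotDr x y z : dot x (y + z) = dot x y + dot x z.
Proof. by rewrite linearD. Qed.

Lemma dotNr x y : dot x (- y) = - dot x y.
Proof. by rewrite linearN. Qed.

Lemma dotZl k x y : dot (k *: x) y = k * dot x y.
Proof. by rewrite linearZl_LR. Qed.

Lemma dotZr k x y : dot x (k *: y) = k * dot x y.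
Proof. by rewrite linearZ. Qed.

Lemma dot_sqr x : dot x x = `|x| ^+ 2.
Proof.
rewrite hdot sqr_sqrtr//; have [->|x0] := eqVneq x 0; first by rewrite linear0.
exact/ltW/neq0_dnorm_gt0.
Qed.

Lemma sqr_normD x y : `|x + y| ^+ 2 = `|x| ^+ 2 + 2 * dot x y + `|y| ^+ 2.
Proof. by rewrite -!dot_sqr dotDl !dotDr (dotC y x); ring. Qed.

Lemma sqr_normB x y : `|x - y| ^+ 2 = `|x| ^+ 2 - 2 * dot x y + `|y| ^+ 2.
Proof. by rewrite sqr_normD dotNr normrN; ring. Qed.

(** Cauchy-Schwarz: expand the square of the norm of
    [`|y| *: x - `|x| *: y]. *)
Lemma dot_le x y : dot x y <= `|x| * `|y|.
Proof.
have [->|x0] := eqVneq x 0; first by rewrite linear0l normr0 mul0r.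
have [->|y0] := eqVneq y 0; first by rewrite linear0 normr0 mulr0.
have xy0 : 0 < `|x| * `|y| by rewrite mulr_gt0// normr_gt0.
rewrite -(ler_pM2l xy0).
have := sqr_ge0 `| `|y| *: x - `|x| *: y |.
rewrite sqr_normB dotZl dotZr !normrZ !normr_id.
move: (dot x y) => d; lra.
Qed.

Lemma normr_dot_le x y : `|dot x y| <= `|x| * `|y|.
Proof.
by rewrite ler_norml dot_le andbT lerNl;
  have := dot_le x (- y); rewrite dotNr normrN.
Qed.

(** The polarization identity writes the inner product through the norm, so
    its joint continuity comes from that of the norm. *)
Lemma cvg_dot (I : Type) (F : set_system I) (FF : Filter F) (f g : I -> H) x y :
  f @ F --> x -> g @ F --> y -> (fun i => dot (f i) (g i)) @ F --> dot x y.
Proof.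
have polar p q : dot p q = 4^-1 * (`|p + q| * `|p + q| - `|p - q| * `|p - q|).
  by rewrite -!expr2 sqr_normD sqr_normB; field.
move=> fx gy; rewrite polar.
under eq_fun do rewrite polar.
apply: cvgM; first exact: cvg_cst.
by apply: cvgB; apply: cvgM; apply: cvg_norm;
  solve [exact: cvgD | exact: cvgB].
Qed.

(** * Finite orthonormal families *)

(** For an orthonormal [s] this is the orthogonal projection on its span;
    finite-dimensional subspaces are handled as fixed-point sets of [proj s]. *)
Definition proj s x := \sum_(e <- s) dot e x *: e.

Definition orthonormal s :=
  all (fun e => dot e e == 1) s && pairwise (fun e f => dot e f == 0) s.

Lemma projD s x y : proj s (x + y) = proj s x + proj s y.
Proof.
rewrite /proj -big_split/=; apply: eq_bigr => e _.
by rewrite dotDr scalerDl.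
Qed.

Lemma projZ s k x : proj s (k *: x) = k *: proj s x.
Proof.
rewrite /proj scaler_sumr; apply: eq_bigr => e _.
by rewrite dotZr scalerA.
Qed.

Lemma projB s x y : proj s (x - y) = proj s x - proj s y.
Proof. by rewrite projD -scaleN1r projZ scaleN1r. Qed.

Lemma proj_sym s x y : dot (proj s x) y = dot x (proj s y).
Proof.
rewrite dotC /proj !linear_sum /=; apply: eq_bigr => e _.
by rewrite !dotZr (dotC y) (dotC x) mulrC.
Qed.

Lemma proj_cons u s x : proj (u :: s) x = dot u x *: u + proj s x.
Proof. by rewrite /proj big_cons. Qed.

Lemma proj_eq0 s x : (forall e, e \in s -> dot e x = 0) -> proj s x = 0.
Proof.
by move=> sx; rewrite /proj big_seq big1// => e /sx ->; rewrite scale0r.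
Qed.

Lemma orthonormal_cons u s : orthonormal (u :: s) <->
  [/\ `|u| = 1, forall e, e \in s -> dot u e = 0 & orthonormal s].
Proof.
rewrite /orthonormal/=; split.
  move=> /andP[/andP[/eqP u1 s1] /andP[/allP us ps]]; split.
  - by apply/eqP; rewrite -(@eqrXn2 _ 2)// -dot_sqr u1 expr1n.
  - by move=> e /us/eqP.
  - by rewrite s1.
move=> [u1 us /andP[-> ->]]; rewrite dot_sqr u1 expr1n eqxx/= andbT.
by apply/allP => e /us ->.
Qed.

Lemma proj_mem s e : orthonormal s -> e \in s -> proj s e = e.
Proof.
elim: s e => // u s IH e /orthonormal_cons[u1 us os].
rewrite inE proj_cons => /predU1P[->|es].
  rewrite dot_sqr u1 expr1n scale1r proj_eq0 ?addr0// => f /us.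
  by rewrite dotC.
by rewrite us// scale0r add0r IH.
Qed.

Lemma proj_idem s x : orthonormal s -> proj s (proj s x) = proj s x.
Proof.
move=> os; rewrite {2}/proj (big_morph (proj s) (projD s) (id1 := 0)); last first.
  by rewrite proj_eq0// => e _; rewrite linear0.
rewrite [RHS]/proj [LHS]big_seq [RHS]big_seq.
by apply: eq_bigr => e es; rewrite projZ proj_mem.
Qed.

Lemma dot_sub_proj s e x : orthonormal s -> e \in s -> dot (x - proj s x) e = 0.
Proof.
move=> os es; rewrite -(proj_mem os es) -proj_sym projB proj_idem//.
by rewrite subrr linear0l.
Qed.

(** The defect [x - proj s x] is orthogonal to [s]; normalizing it gives the
    vector that enlarges the span just enough to contain [x]. *)
Lemma gram_schmidt s x : orthonormal s -> proj s x <> x ->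
  let u := `|x - proj s x|^-1 *: (x - proj s x) in
  [/\ orthonormal (u :: s), proj (u :: s) x = x &
      forall y, proj s y = y -> proj (u :: s) y = y].
Proof.
move=> os /eqP px /=; set r := x - proj s x.
have r0 : `|r| != 0 by rewrite normr_eq0 subr_eq0 eq_sym.
split.
- apply/orthonormal_cons; split => //.
    by rewrite normrZ normfV normr_id mulVf.
  by move=> e es; rewrite dotZl dot_sub_proj// mulr0.
- have rx : dot r x = `|r| ^+ 2.
    rewrite -[X in dot r X](subrK (proj s x)) -/r dotDr dot_sqr.
    by rewrite -proj_sym projB proj_idem// subrr linear0l addr0.
  rewrite proj_cons dotZl rx expr2 mulKf// scalerA divff//.
  by rewrite scale1r subrK.
- move=> y sy; rewrite proj_cons dotZl -sy.
  by rewrite -proj_sym projB proj_idem// subrr linear0l mulr0 scale0r add0r sy.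
Qed.

Lemma extend_orthonormal s (t : seq H) : orthonormal s ->
  exists s', [/\ orthonormal s', forall x, x \in t -> proj s' x = x &
    forall y, proj s y = y -> proj s' y = y].
Proof.
move=> os; elim: t => [|x t [s' [os' ts' ss']]]; first by exists s.
have [sx|sx] := pselect (proj s' x = x).
  by exists s'; split=> // y; rewrite inE => /predU1P[->|/ts'].
have [ous ux us] := gram_schmidt os' sx.
eexists; split; first exact: ous.
  by move=> y; rewrite inE => /predU1P[->//|/ts'/us].
by move=> y /ss'/us.
Qed.

(** By induction on [s], [proj s] sends the ball into a compact set: each vector
    [u] of [s] contributes a coordinate [dot u x] that ranges over a segment. *)
Lemma proj_ball_compact s (r : R) : compact [set x | proj s x = x /\ `|x| <= r].
Proof.
have [K cK sK] : exists2 K : set H, compact K &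
    forall x, `|x| <= r -> K (proj s x).
  elim: s => [|u s [K cK sK]].
    exists [set 0]; first exact: compact_set1.
    by move=> x _; rewrite /proj big_nil.
  pose f (p : H * R) : H := p.2 *: u + p.1.
  exists (f @` (K `*` `[- (`|u| * r), `|u| * r])).
    apply: continuous_compact; last first.
      by apply: compact_setX => //; exact: segment_compact.
    apply: continuous_subspaceT => p; apply: cvgD; last exact: cvg_fst.
    by apply: cvgZr_tmp; exact: cvg_snd.
  move=> x xr; exists (proj s x, dot u x); last by rewrite proj_cons.
  split; first exact: sK.
  rewrite /= in_itv/= -ler_norml (le_trans (normr_dot_le _ _))//.
  by rewrite ler_wpM2l.
apply: (subclosed_compact _ cK) => [|x [sx xr]]; last first.
  by rewrite -sx; exact: sK.
have cproj : continuous (proj s).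
  move=> x; rewrite /proj; apply: cvg_big => [|e _]; first exact: add_continuous.
  by apply: cvgZr_tmp; apply: cvg_dot; [exact: cvg_cst|exact: cvg_id].
have -> : [set x | proj s x = x /\ `|x| <= r] =
    (fun x => `|x - proj s x|) @^-1` [set t | t <= 0] `&`
    (fun x => `|x|) @^-1` [set t | t <= r].
  apply/seteqP; split => x /= [].
    by move=> -> xr; rewrite subrr normr0.
  by rewrite normr_le0 subr_eq0 => /eqP <-.
apply: closedI; apply: preimage_closed; try exact: closed_le.
  move=> x _; apply: cvg_norm; apply: cvgB; [exact: cvg_id|exact: cproj].
by move=> x _; exact: norm_continuous.
Qed.
End InnerProduct.

(** * Compact self-adjoint operators with closed range have finite rank *)

Section FiniteRank.
Context (R : realType) (H : completeNormedModType R)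
  (dot : {dot H for @idfun R}) (hdot : induces_norm dot).
Implicit Types (x y z u v : H) (s : seq H) (e : nat -> H).
Local Notation proj := (proj dot).
Local Notation orthonormal := (orthonormal dot).

(** Run Gram-Schmidt inside [V]: either it stops, on a basis of [V], or it
    produces an infinite orthonormal sequence. *)
Lemma finite_basis_or_orthonormal_sequence (V : set H) :
  (forall k x y, V x -> V y -> V (k *: x + y)) ->
  (exists2 s, orthonormal s & forall y, V y -> proj s y = y) \/
  (exists2 e, forall n, V (e n) &
     forall i j : nat, dot (e i) (e j) = (i == j)%:R).
Proof.
move=> Vlin; pose good s := orthonormal s /\ forall x, x \in s -> V x.
have [[s [os sV] sfull]|nofull] :=
  pselect (exists2 s, good s & forall y, V y -> proj s y = y).
  by left; exists s.
right.
have VB x y : V x -> V y -> V (x - y).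
  by move=> Vx Vy; rewrite addrC -scaleN1r; exact: Vlin.
have extend s : {u | good s -> good (u :: s)}.
  apply: cid; have [gs|] := pselect (good s); last by exists 0.
  have [y [Vy sy]] : exists y, V y /\ proj s y <> y.
    apply: contrapT => noy; apply: nofull; exists s => // y Vy.
    by apply: contrapT => sy; apply: noy; exists y.
  have [os _ _] := gram_schmidt hdot gs.1 sy.
  eexists => _; split; first exact: os.
  move=> x; rewrite inE => /predU1P[->|]; last exact: gs.2.
  have VZ k z : V z -> V (k *: z).
    move=> Vz; rewrite -[k *: z]addr0 -(subrr z) addrA.
    by apply: VB => //; exact: Vlin.
  apply: (VZ); apply: (VB) => //.
  (* [V] contains the linear combinations of its vectors. *)
  suff : forall t, (forall x, x \in t -> V x) -> V (proj t y) by apply; exact: gs.2.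
  elim=> [|f t IH] tV.
    by rewrite /proj big_nil -(subrr y); exact: VB.
  rewrite proj_cons; apply: Vlin; first by apply: tV; rewrite mem_head.
  by apply: IH => z zt; apply: tV; rewrite inE zt orbT.
(* [L n] lists the first [n] vectors, the last one at its head. *)
pose L n := iter n (fun s => sval (extend s) :: s) [::].
pose e n := sval (extend (L n)).
have goodL n : good (L n).
  by elim: n => [|n IH]; [split|exact: (svalP (extend (L n)) IH)].
have eL i j : (i < j)%N -> e i \in L j.
  elim: j => // j IH; rewrite ltnS leq_eqVlt inE => /predU1P[->|/IH ->].
    by rewrite eqxx.
  by rewrite orbT.
have ort n : [/\ `|e n| = 1, forall f, f \in L n -> dot (e n) f = 0 &
    orthonormal (L n)].
  exact/(orthonormal_cons hdot)/(goodL n.+1).1.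
exists e => [n|i j]; first by apply: (goodL n.+1).2; rewrite mem_head.
have [_ ei _] := ort i; have [_ ej _] := ort j.
case: ltngtP => [ij|ji|->].
- by rewrite dotC ej// eL.
- by rewrite ei// eL.
- by have [ej1 _ _] := ort j; rewrite dot_sqr// ej1 expr1n.
Qed.

(** Bessel: the squared coordinates of [v] have partial sums at most
    [`|v| ^+ 2], so they tend to 0. *)
Lemma orthonormal_weakly_cvg0 e :
  (forall i j : nat, dot (e i) (e j) = (i == j)%:R) -> weakly_cvg_to dot e 0.
Proof.
move=> oe v; rewrite linear0 /=.
(* [r n] is the component of [v] orthogonal to the first [n] vectors. *)
pose r n := v - \sum_(k < n) dot (e k) v *: e k.
have dr n m : (n <= m)%N -> dot (e m) (r n) = dot (e m) v.
  move=> nm; rewrite /r dotDr dotNr linear_sum /= big1 ?subr0// => k _.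
  by rewrite dotZr oe gtn_eqF ?mulr0// (leq_trans (ltn_ord k) nm).
have bessel n : `|r n| ^+ 2 = `|v| ^+ 2 - \sum_(k < n) dot (e k) v ^+ 2.
  elim: n => [|n IH]; first by rewrite /r !big_ord0 !subr0.
  have -> : r n.+1 = r n - dot (e n) v *: e n.
    by rewrite /r big_ord_recr/= opprD addrA.
  rewrite (sqr_normB hdot) dotZr [dot (r n) _]dotC dr// IH big_ord_recr/=.
  by rewrite -(dot_sqr hdot (_ *: _)) dotZl dotZr oe eqxx /= mulr1; ring.
have c2 : cvgn (series (fun k => dot (e k) v ^+ 2)).
  apply: nondecreasing_is_cvgn.
    by apply/nondecreasing_seqP => n; rewrite seriesSr lerDl sqr_ge0.
  exists (`|v| ^+ 2) => _ [n _ <-].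
  by rewrite seriesEord -subr_ge0 -bessel sqr_ge0.
have {c2} /cvgrPdist_lt c0 := cvg_series_cvg_0 c2.
apply/cvgrPdist_lt => eps eps0.
have [N _ hN] := c0 _ (exprn_gt0 2 eps0); exists N => // n Nn.
have := hN n Nn; rewrite /= !sub0r !normrN [dot v _]dotC normrX.
by rewrite ltr_pXn2r// ?nnegrE// ltW.
Qed.

(** Injectivity of the extraction keeps the subsequence orthonormal when the
    terms of [u] are indexed by an orthonormal family. *)
Lemma fast_subsequence (u eps : R^nat) : u @ \oo --> 0 -> (forall n, 0 < eps n) ->
  exists2 f : nat -> nat, injective f & forall k, `|u (f k)| <= eps k.
Proof.
move=> /cvgr0Pnorm_le u0 eps0.
have next k m : {n | (m < n)%N /\ `|u n| <= eps k}.
  apply: cid; have [N _ hN] := u0 _ (eps0 k).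
  exists (N + m.+1)%N; split; first by rewrite leq_addl.
  by apply: hN => /=; rewrite leq_addr.
pose f := fix f k :=
  if k is k'.+1 then sval (next k (f k')) else sval (next 0%N 0%N).
exists f; last first.
  case=> [|k]; first by case: (svalP (next 0%N 0%N)).
  by case: (svalP (next k.+1 (f k))).
apply: increasing_seq_injective; apply/increasing_seqP => k.
by case: (svalP (next k.+1 (f k))).
Qed.

Context (T : {linear H -> H}) (hTsa : self_adjoint dot T).

(** If [T (e n)] tended to 0, the range would contain the sum of the series
    [2^-k *: e (f k)] along an extraction [f] with [`|T (e (f k))| <= 4^-k].  An
    antecedent [z] of that sum would satisfy [2^k <= `|z|] for every [k]. *)
Lemma closed_range_orthonormal_Ncvg0 e : closed (range T) ->
  (forall n, range T (e n)) -> (forall i j : nat, dot (e i) (e j) = (i == j)%:R) ->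
  ~ (T \o e @ \oo --> 0).
Proof.
move=> clT eT oe Te0.
have [f finj fT] : exists2 f : nat -> nat, injective f &
    forall k, `|T (e (f k))| <= 4^-1 ^+ k.
  have [] := @fast_subsequence (fun n => `|T (e n)|) (fun k => 4^-1 ^+ k).
  - by rewrite -(normr0 H); apply: cvg_norm.
  - by move=> n; rewrite exprn_gt0// invr_gt0.
  - by move=> f fi fT; exists f => // k; have := fT k; rewrite normr_id.
have norm_e n : `|e n| = 1.
  by apply/eqP; rewrite -(@eqrXn2 _ 2)// -(dot_sqr hdot) oe eqxx expr1n.
pose g k : H := 2^-1 ^+ k *: e (f k).
have gcvg : cvgn (series g).
  apply: normed_cvg.
  have -> : [normed series g] = series (geometric 1 2^-1).
    rewrite /series/=; apply/funext => n; apply: eq_bigr => k _.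
    by rewrite /= /g normrZ norm_e mulr1 mul1r ger0_norm// exprn_ge0// invr_ge0.
  apply: is_cvg_geometric_series.
  by rewrite ger0_norm ?invr_ge0// invf_lt1// ltr1n.
pose y := limn (series g).
have [z _ Tz] : range T y.
  refine (@closed_cvg _ _ _ _ (series g) (range T) clT _ y gcvg); near=> n.
  rewrite /series/=; elim: (index_iota 0 n) => [|k l [z _ zE]].
    by exists 0 => //; rewrite big_nil linear0.
  have [w _ wE] := eT (f k).
  by exists (2^-1 ^+ k *: w + z) => //; rewrite big_cons -zE linearP wE.
have coef k : dot (e (f k)) y = 2^-1 ^+ k.
  have : (fun n => dot (e (f k)) (series g n)) @ \oo --> dot (e (f k)) y.
    by apply: cvg_dot => //; exact: cvg_cst.
  move/cvg_lim => <- //; apply: lim_near_cst => //; near=> n.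
  rewrite seriesEord linear_sum /=.
  have kn : (k < n)%N by near: n; exact: nbhs_infty_gt.
  rewrite (bigD1 (Ordinal kn))//= big1 ?addr0 => [|i].
    by rewrite /g dotZr oe eqxx mulr1.
  by rewrite -val_eqE/= /g dotZr oe (inj_eq finj) eq_sym => /negPf ->; rewrite mulr0.
have bound k : 2 ^+ k <= `|z|.
  have : dot (e (f k)) y <= `|T (e (f k))| * `|z|.
    by rewrite -Tz -hTsa; exact: dot_le.
  rewrite coef => /le_trans /(_ (ler_wpM2r (normr_ge0 z) (fT k))).
  have -> : (4^-1 : R) = 2^-1 * 2^-1 by field.
  rewrite exprMn -mulrA ler_pMr ?exprn_gt0 ?invr_gt0//.
  by rewrite exprVn mulrC ler_pdivlMr ?exprn_gt0// mul1r.
have := bound (Num.bound `|z|).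
rewrite leNgt => /negP; apply; apply: lt_le_trans (archi_boundP _) _ => //.
by rewrite -natrX ler_nat ltnW// ltn_expl.
Unshelve. all: end_near. Qed.

(** An orthonormal sequence in the range would be weakly null, and compactness
    would make its image norm-convergent, necessarily to 0. *)
Lemma compact_closed_range_finite_rank :
  compact_operator dot T -> closed (range T) ->
  exists2 s, orthonormal s & forall x, proj s (T x) = T x.
Proof.
move=> cT clT.
have [k x y [p _ <-] [q _ <-]||[e eT oe]] :=
    @finite_basis_or_orthonormal_sequence (range T).
- by exists (k *: p + q) => //; rewrite linearP.
- by move=> [s os sT]; exists s => // x; apply: sT; exists x.
have e0 := orthonormal_weakly_cvg0 oe.
exfalso; apply: (closed_range_orthonormal_Ncvg0 clT eT oe).
have Te : cvgn (T \o e) by apply: cT; exists 0.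
suff <- : limn (T \o e) = 0 by [].
(* The strong limit is also the weak limit, which is 0 by self-adjointness. *)
set y := limn _.
apply/eqP; rewrite -normr_eq0 -(@eqrXn2 _ 2)// expr0n/= -(dot_sqr hdot); apply/eqP.
have : (fun n => dot y (T (e n))) @ \oo --> dot y y.
  by apply: cvg_dot => //; exact: cvg_cst.
move/cvg_lim => <- //; apply/cvg_lim => //.
under eq_fun do rewrite -hTsa.
by have := e0 (T y); rewrite linear0.
Qed.

End FiniteRank.

(** * The Frank-Wolfe theorem *)

Lemma compact_subsequence (R : realType) (H : normedModType R) (K : set H)
    (w : nat -> H) : compact K -> (forall n, K (w n)) ->
  exists2 u, K u & exists2 f : nat -> nat,
    forall k, (k <= f k)%N & w \o f @ \oo --> u.
Proof.
move=> cK wK; have [u [Ku clu]] := cK (w @ \oo) _ (filterE _ wK).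
exists u => //.
have sel k : {n | (k <= n)%N /\ `|u - w n| < k.+1%:R^-1}.
  apply: cid.
  have tail : (w @ \oo) (w @` [set n | (k <= n)%N]).
    by exists k => // n kn; exists n.
  have [|_ [[n kn <-] un]] := clu _ _ tail (nbhsx_ballx u k.+1%:R^-1 _).
    by rewrite invr_gt0.
  by exists n; split => //; move: un; rewrite -ball_normE.
exists (fun k => sval (sel k)) => [k|]; first by case: (svalP (sel k)).
apply/cvgrPdist_lt => eps eps0.
near=> k; apply: (lt_trans (svalP (sel k)).2).
by near: k; exact: near_infty_natSinv_lt (PosNum eps0).
Unshelve. all: end_near. Qed.

Section FrankWolfe.
Context (R : realType) (H : completeNormedModType R)
  (dot : {dot H for @idfun R}) (hdot : induces_norm dot)
  (T : {linear H -> H}) (hTcont : continuous T) (hTsa : self_adjoint dot T)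
  (m : nat) (c : H) (a : 'I_m -> H) (alpha : 'I_m -> R).
Implicit Types (x y z u v : H).
Local Notation f := (quad_fun dot T c).
Local Notation feasible := (feasible_set dot a alpha).

Lemma quad_fun_continuous : continuous f.
Proof.
move=> x; apply: cvgD; last by apply: cvg_dot => //; exact: cvg_cst.
by apply: cvgM; [exact: cvg_cst|apply: cvg_dot => //; exact: hTcont].
Qed.

Lemma quad_fun_line x u t :
  f (x + t *: u) = f x + t * dot (T x + c) u + 2^-1 * t ^+ 2 * dot u (T u).
Proof.
rewrite /quad_fun linearD linearZ /= !dotDl !dotDr !dotZl !dotZr.
by rewrite (dotC dot u (T x)) hTsa; field.
Qed.

Lemma feasible_closed : closed feasible.
Proof.
have -> : feasible = \bigcap_(i in [set: 'I_m])
    ((fun x => dot (a i) x + alpha i) @^-1` [set t | t <= 0]).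
  by apply/seteqP; split=> x /= h i => [_|]; exact: h.
apply: closed_bigI => i _; apply: preimage_closed; last exact: closed_le.
move=> x _; apply: cvgD; last exact: cvg_cst.
by apply: cvg_dot => //; exact: cvg_cst.
Qed.

(** [V] is a linear subspace whose closed balls are compact, that is, a
    finite-dimensional one. *)
Context (V : set H) (Vlin : forall k x y, V x -> V y -> V (k *: x + y))
  (Vcompact : forall r : R, compact [set x | V x /\ `|x| <= r]).
Local Notation C := (V `&` feasible).

(** This is what is left of being a minimizer of least norm over a ball once the
    radius is forgotten: points outside the ball have a larger norm anyway. *)
Definition least_norm_at_level x := C x /\
  forall y, C y -> f y <= f x -> `|x| <= `|y|.

(** Two successive minimizations over compact sets, of [f] and then of the norm
    over the minimizers of [f]. *)
Lemma ball_minimizer r x0 : C x0 -> `|x0| <= r ->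
  exists2 x, least_norm_at_level x & forall y, C y -> `|y| <= r -> f x <= f y.
Proof.
move=> Cx0 x0r; pose B := [set x | V x /\ `|x| <= r] `&` feasible.
have cB : compact B by apply: compact_closedI => //; exact: feasible_closed.
have B0 : B !=set0 by exists x0; split; [split; [exact: Cx0.1|]|exact: Cx0.2].
have [|x1 /set_mem Bx1 minx1] := compact_EVT_min B0 cB (f := f).
  exact/continuous_subspaceT/quad_fun_continuous.
pose S := B `&` f @^-1` [set t | t <= f x1].
have cS : compact S.
  apply: compact_closedI => //; apply: preimage_closed; last exact: closed_le.
  by move=> x _; exact: quad_fun_continuous.
have S0 : S !=set0 by exists x1; split => /=.
have [|x /set_mem [[[Vx xr] Fx] fx] minx] :=
    compact_EVT_min S0 cS (f := fun x => `|x|).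
  by apply: continuous_subspaceT => x; exact: norm_continuous.
exists x => [|y [Vy Fy] yr]; last first.
  by apply: (le_trans fx); apply: minx1; rewrite inE.
split => // y [Vy Fy] fyx; have [yr|/ltW ry] := leP `|y| r.
  by apply: minx; rewrite inE; split=> //; exact: le_trans fyx fx.
exact: le_trans ry.
Qed.

(** Blum and Oettli: an unbounded family of least-norm points would have a
    limit direction [u] such that moving a far point by [- u] keeps it feasible,
    does not increase [f] and brings it closer to the origin. *)
Lemma least_norm_at_level_bounded (x0 : H) (M : R) (y : nat -> H) :
  (forall x, C x -> M <= f x) -> (forall k, least_norm_at_level (y k)) ->
  (forall k, f (y k) <= f x0) -> exists k, `|y k| <= k%:R.
Proof.
move=> lb ymin yf; apply: contrapT => /forallNP unb.
have {}unb k : k%:R < `|y k| by rewrite ltNge; apply/negP/unb.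
have ygt0 k : 0 < `|y k| by apply: le_lt_trans (unb k).
have V0 : V 0.
  by have Vy := (ymin 0%N).1.1; rewrite -(subrr (y 0%N)) addrC -scaleN1r; exact: Vlin.
have VZ k x : V x -> V (k *: x) by move=> Vx; rewrite -[_ *: _]addr0; exact: Vlin.
have [|u [Vu _] [p pge wu]] :=
    @compact_subsequence _ _ _ (fun k => `|y k|^-1 *: y k) (@Vcompact 1).
  move=> k; split; first exact/VZ/(ymin k).1.1.
  by rewrite normrZ normfV normr_id mulVf// gt_eqF.
pose z k := y (p k); pose w k := `|z k|^-1 *: z k; pose q k := `|z k|^-1.
have {}wu : w @ \oo --> u := wu.
have zC k : C (z k) := (ymin (p k)).1.
have zgt k : k%:R < `|z k|.
  by apply: le_lt_trans (unb (p k)); rewrite ler_nat pge.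
have z0 k : `|z k| != 0 by rewrite gt_eqF ?ygt0.
have q0 : q @ \oo --> 0.
  apply/cvgr0Pnorm_lt => eps eps0; near=> k.
  rewrite ger0_norm ?invr_ge0//.
  apply: (@lt_trans _ _ k%:R^-1); last first.
    rewrite invf_plt ?posrE//; last first.
      by rewrite ltr0n; near: k; exact: nbhs_infty_gt.
    by near: k; exact: nbhs_infty_gtr.
  rewrite ltf_pV2 ?posrE ?ygt0//.
  by rewrite ltr0n; near: k; exact: nbhs_infty_gt.
have cdot v : (fun k => dot v (w k)) @ \oo --> dot v u.
  by apply: cvg_dot => //; exact: cvg_cst.
have dotw v k : dot v (w k) = q k * dot v (z k) by rewrite /w dotZr.
(* [u] is a unit recession direction along which [f] has no quadratic part. *)
have u1 : `|u| = 1.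
  have nw : (fun k => `|w k|) @ \oo --> `|u| by exact: cvg_norm.
  rewrite -(cvg_lim (@Rhausdorff R) nw); apply: lim_near_cst => //; near=> k.
  by rewrite normrZ normfV normr_id mulVf.
have au i : dot (a i) u <= 0.
  have : (fun k => dot (a i) (w k) + q k * alpha i) @ \oo --> dot (a i) u + 0 * alpha i.
    by apply: cvgD => //; apply: cvgM => //; exact: cvg_cst.
  rewrite mul0r addr0 => /cvgr_to_le; apply.
  near=> k; rewrite /= dotw -mulrDr pmulr_rle0 ?invr_gt0 ?ygt0//.
  exact: (zC k).2.
have uTu : dot u (T u) = 0.
  have lim1 : (fun k => 2^-1 * dot (w k) (T (w k)) + q k * dot c (w k)) @ \oo -->
      2^-1 * dot u (T u) + 0 * dot c u.
    apply: cvgD; apply: cvgM => //; first exact: cvg_cst.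
    by apply: cvg_dot => //; apply: continuous_cvg => //; exact: hTcont.
  (* [f (z k)] stays between [M] and [f x0]. *)
  have lim0 : (fun k => q k * (q k * f (z k))) @ \oo --> 0.
    pose B := Num.max `|M| `|f x0|.
    have fB k : `|f (z k)| <= B.
      rewrite ler_norml; apply/andP; split.
        apply: le_trans (lb _ (zC k)); rewrite lerNl.
        by rewrite le_max -normrN ler_norm.
      by apply: le_trans (yf (p k)) _; rewrite le_max ler_norm orbT.
    have qqB : (fun k => q k * (q k * B)) @ \oo --> 0.
      rewrite -(mul0r (0 * B)); apply: cvgM => //; apply: cvgM => //.
      exact: cvg_cst.
    have qqNB : (fun k => - (q k * (q k * B))) @ \oo --> 0.
      by rewrite -oppr0; exact: cvgN.
    apply: squeeze_cvgr qqNB qqB; near=> k; rewrite -ler_norml !normrM.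
    have qk : 0 <= q k by rewrite invr_ge0.
    by rewrite (ger0_norm qk) !ler_wpM2l.
  have qf k : q k * (q k * f (z k)) = 2^-1 * dot (w k) (T (w k)) + q k * dot c (w k).
    by rewrite /w linearZ /= !dotZl !dotZr /quad_fun /q; ring.
  have : 2^-1 * dot u (T u) + 0 * dot c u = 0.
    rewrite -(cvg_lim (@Rhausdorff R) lim1); apply/(cvg_lim (@Rhausdorff R)).
    by under eq_fun do rewrite -qf.
  rewrite mul0r addr0 => /eqP.
  by rewrite mulf_eq0 invr_eq0 pnatr_eq0/= => /eqP.
(* [f] is affine on the feasible ray from [x] along [u] and bounded below by
   [M]; a negative slope [g] would give the value [M - 1] at [t]. *)
have slope x : C x -> 0 <= dot (T x + c) u.
  move=> [Vx Fx]; rewrite leNgt; apply/negP => g0.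
  set g := dot _ u in g0; pose t := (f x - M + 1) / - g.
  have t0 : 0 <= t.
    apply: divr_ge0; last by rewrite oppr_ge0 ltW.
    by rewrite addr_ge0// subr_ge0 lb.
  have := lb (x + t *: u).
  rewrite quad_fun_line uTu mulr0 addr0 -/g => /(_ _).
  have -> : t * g = - (f x - M + 1) by rewrite /t; field; rewrite lt_eqF.
  suff Cxt : C (x + t *: u) by move=> /(_ Cxt); lra.
  split; first by rewrite addrC; exact: Vlin.
  move=> i; rewrite dotDr dotZr addrAC.
  have := Fx i; have := mulr_ge0_le0 t0 (au i); lra.
have [k [Czu zu]] : exists k, C (z k - u) /\ 1 < 2 * dot (z k) u.
  have Fzu i : \forall k \near \oo, dot (a i) (z k - u) + alpha i <= 0.
    (* A constraint constant along [u] keeps its value; any other one is more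
       and more slack along the sequence, with margin linear in [`|z k|]. *)
    have [aui|aui] := eqVneq (dot (a i) u) 0.
      by near=> k; rewrite dotDr dotNr aui subr0; exact: (zC k).2.
    have d0 : dot (a i) u < 0 by rewrite lt_neqAle aui au.
    near=> k; have zpos := ygt0 (p k); rewrite -/(z k) in zpos.
    have : dot (a i) (w k) < 2^-1 * dot (a i) u.
      near: k; apply: (cvgr_lt _ (cdot (a i))); lra.
    rewrite dotw /q mulrC ltr_pdivrMr//.
    have : 2 * (`|alpha i| - dot (a i) u) / (- dot (a i) u) < `|z k|.
      apply: lt_trans (zgt k); near: k; exact: nbhs_infty_gtr.
    rewrite ltr_pdivrMr ?oppr_gt0//.
    have := ler_norm (alpha i); rewrite dotDr dotNr.
    move: (dot (a i) u) (dot (a i) (z k)) `|alpha i| => A D L; lra.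
  have small : \forall k \near \oo, 2^-1 < dot u (w k).
    apply: (cvgr_gt _ (cdot u)); rewrite dot_sqr// u1 expr1n; lra.
  near \oo => k; exists k; split.
    split; first by rewrite addrC -scaleN1r; apply: Vlin => //; exact: (zC k).1.
    by near: k; exact: filter_forall.
  have : 2^-1 < dot u (w k) by near: k.
  have : 1 < `|z k|.
    by apply: lt_trans (zgt k); rewrite ltr1n; near: k; exact: nbhs_infty_gt.
  rewrite dotw /q mulrC ltr_pdivlMr ?ygt0// dotC; lra.
have := (ymin (p k)).2 _ Czu; rewrite -/(z k).
have fzu : f (z k - u) <= f (z k).
  rewrite -[- u]scaleN1r quad_fun_line uTu.
  by have := slope _ (zC k); lra.
move=> /(_ fzu); rewrite leNgt => /negP; apply.
rewrite -(@ltr_pXn2r _ 2) ?nnegrE// (sqr_normB hdot) u1; lra.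
Unshelve. all: end_near. Qed.

Theorem frank_wolfe : C !=set0 -> has_lbound (f @` C) ->
  exists2 x, C x & forall y, C y -> f x <= f y.
Proof.
move=> [x0 Cx0] [M lbM].
have lb x : C x -> M <= f x by move=> Cx; apply: lbM; exists x.
have [x xP] : {x : nat -> H & forall n, least_norm_at_level (x n) /\
    forall y, C y -> `|y| <= `|x0| + n%:R -> f (x n) <= f y}.
  apply: (@choice _ _ (fun n x => least_norm_at_level x /\
    forall y, C y -> `|y| <= `|x0| + n%:R -> f x <= f y)) => n.
  by have [|x] := @ball_minimizer (`|x0| + n%:R) x0 Cx0; rewrite ?lerDl//; exists x.
(* When every [x n] has norm at most [N], each is a competitor for [x N]. *)
have [[N xN]|unb] := pselect (exists N : nat, forall n, `|x n| <= N%:R).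
  exists (x N); first exact: (xP N).1.1.
  move=> y Cy; pose n := Num.bound `|y|.
  apply: (@le_trans _ _ (f (x n))).
    apply: (xP N).2; first exact: (xP n).1.1.
    by apply: le_trans (xN n) _; rewrite lerDr.
  apply: (xP n).2 => //; apply: le_trans (ltW (archi_boundP _)) _ => //.
  by rewrite lerDr.
have far k : {n | k%:R < `|x n|}.
  apply: cid; apply: contrapT => nok; apply: unb; exists k => n.
  by rewrite leNgt; apply/negP => kn; apply: nok; exists n.
have [k|k|k] := @least_norm_at_level_bounded x0 M (fun k => x (sval (far k))) lb.
- exact: (xP _).1.
- by apply: (xP _).2 => //; rewrite lerDl.
- by rewrite leNgt (svalP (far k)).
Qed.

End FrankWolfe.

Theorem corollary3p5 (R : realType) (H : completeNormedModType R)
    (dot : {dot H for @idfun R}) (hdot : induces_norm dot)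
    (m : nat) (hm : (0 < m)%N)
    (T : {linear H -> H}) (hTcont : continuous T) (hTsa : self_adjoint dot T)
    (c : H) (a : 'I_m -> H) (alpha : 'I_m -> R)
    (hTcompact : compact_operator dot T) (hTclosed : closed (range T))
    (hF : feasible_set dot a alpha !=set0)
    (hbounded : has_lbound (quad_fun dot T c @` feasible_set dot a alpha)) :
  exists xbar : H, feasible_set dot a alpha xbar /\
    forall x : H, feasible_set dot a alpha x ->
      quad_fun dot T c xbar <= quad_fun dot T c x.
Proof.
have [s0 os0 s0T] := compact_closed_range_finite_rank hdot hTsa hTcompact hTclosed.
have [s [os sac s0s]] := extend_orthonormal hdot (c :: codom a) os0.
have sT x : proj dot s (T x) = T x by exact/s0s/s0T.
have sc : proj dot s c = c by apply: sac; rewrite mem_head.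
have sa i : proj dot s (a i) = a i by apply: sac; rewrite inE codom_f orbT.
(* [T] and [proj s] are self-adjoint, so [proj s \o T = T] transposes. *)
have Ts x : T (proj dot s x) = T x.
  apply/eqP; rewrite -subr_eq0 -normr_eq0 -sqrf_eq0 -(dot_sqr hdot).
  set d := _ - _; rewrite {1}/d dotDl -scaleN1r dotZl !hTsa.
  by rewrite proj_sym sT mulN1r subrr.
have qs x : quad_fun dot T c (proj dot s x) = quad_fun dot T c x.
  by rewrite /quad_fun Ts proj_sym sT -proj_sym sc.
have Fs x : feasible_set dot a alpha x -> feasible_set dot a alpha (proj dot s x).
  by move=> Fx i; rewrite -proj_sym sa; exact: Fx.
pose V := [set x | proj dot s x = x].
have [||||x [_ Fx] minx] := @frank_wolfe _ _ _ hdot T hTcont hTsa m c a alpha V.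
- by move=> k x y; rewrite /V/= projD projZ => -> ->.
- exact: proj_ball_compact.
- have [x Fx] := hF; exists (proj dot s x); split; [exact: proj_idem|exact: Fs].
- have [M lbM] := hbounded; exists M => _ [x [_ Fx] <-]; apply: lbM.
  by exists x.
exists x; split=> // y Fy; rewrite -(qs y); apply: minx; split; last exact: Fs.
exact: proj_idem.
Qed.
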